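(* Let $K$ be a field, $I$ a monomial ideal of $S=K[x_1,\dots,x_n]$, and $\prec$ a total order on $G(I)$ such that the Lyubeznik resolution of $I$ under $\prec$ is minimal. If $C$ is an M-minimal complete cover of $G(I)$, then either $\mathcal{I}(C)\neq\emptyset$ or $\mathcal{E}(C)\neq\emptyset$. Furthermore, exactly one of the following cases occurs: (1) $\mathcal{I}(C)\neq\emptyset$. In this case, $\mathcal{I}(C)\prec C\setminus\mathcal{I}(C)$. (2) $\mathcal{I}(C)=\emptyset$ and $\mathcal{E}(C)\neq\emptyset$. In this case, $\mathcal{E}(C)\prec C\setminus\mathcal{E}(C)$.
   Context: For a monomial ideal $I$, $G(I)$ is its minimal set of monomial generators. For $A\subseteq G(I)$, the multidegree $m(A)$ is the least common multiple of the elements of $A$. A subset $C\subseteq G(I)$ is a cover of $u\in C$ if $u\mid m(C\setminus\{u\})$; $C$ is a cover if it is a cover of some $u\in C$. The complete cover induced by a cover $C$ is $\overline{C}=\{w\in G(I): w\mid m(C)\}$; a complete cover is a set of this form. A cover $C$ is M-minimal (an M-minimal cover of $G(I)$) if there is no cover $V\subseteq G(I)$ whose multidegree $m(V)$ is a proper factor of $m(C)$. An M-minimal complete cover is a complete cover that is M-minimal. For a cover $C$, an out set of $C$ is a subset $D\subseteq C$ with $m(D)=m(C)$ such that no proper subset of $D$ has multidegree $m(D)$. $\mathcal{I}(C)$ is the set of inner points of $C$, i.e. points of $C$ lying in no out set of $C$. An element $u\in C\setminus\mathcal{I}(C)$ is exchangeable in $C$ if for every out set $D$ of $C$ containing $u$,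 one has $m((D\setminus\{u\})\cup\{v\})=m(D)$ for every $v\in C\setminus D$; $\mathcal{E}(C)$ is the set of exchangeable points of $C$. For a total order $\prec$ on $G(I)$ and subsets $A,B\subseteq G(I)$, $A\prec B$ means $\min(A)\prec\min(B)$, where $\min$ denotes the least element under $\prec$; for nonempty $A$ the relation $A\prec\emptyset$ is regarded as vacuously true. The Lyubeznik simplicial complex $L_{(I,\prec)}$ is the simplicial complex on $G(I)$ whose faces are the $F\subseteq G(I)$ such that for every nonempty $G\subseteq F$, $\min\{u\in G(I): u\mid m(G)\}\in G$. The Lyubeznik resolution of $I$ under $\prec$ is the free resolution $\cdots\to L_2\xrightarrow{\varphi_1}L_1\xrightarrow{\varphi_0}I\to0$, where $L_i$ is the free $S$-module with basis the faces $F\in L_{(I,\prec)}$ with $|F|=i$, $\varphi_0(\{u\})=u$, and for a face $F=\{u_{j_1}\prec\cdots\prec u_{j_i}\}$ with $i\ge2$, $\varphi_{i-1}(F)=\sum_{k=1}^{i}(-1)^{k+1}\frac{m(F)}{m(G_k)}G_k$ with $G_k=F\setminus\{u_{j_k}\}$. It is known that this is a free resolution of $I$. It is minimal if $\varphi_{i-1}(L_i)\subseteq(x_1,\dots,x_n)L_{i-1}$ for all $i\ge2$. *)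

(* Defs.v *)
From mathcomp Require Import all_boot all_algebra.
From mathcomp Require Export finmap mpoly.

Set Implicit Arguments.
Unset Strict Implicit.
Unset Printing Implicit Defensive.

Import GRing.Theory.

Local Open Scope fset_scope.
Local Open Scope ring_scope.

Definition ideal_span (S : comNzRingType) (A : S -> Prop) (p : S) : Prop :=
  exists s : seq (S * S),
    (forall x, x \in s -> A x.2) /\ p = \sum_(x <- s) x.1 * x.2.

Definition ideal_scale (S : comNzRingType) (M : lmodType S) (J : S -> Prop)
    (w : M) : Prop :=
  exists s : seq (S * M),
    (forall x, x \in s -> J x.1) /\ w = \sum_(x <- s) x.1 *: x.2.

Section MonomialIdeals.
Variables (K : fieldType) (n : nat).
Implicit Types (I : {mpoly K[n]} -> Prop).

Definition generates (A : 'X_{1..n} -> Prop) I : Prop :=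
  forall p, I p <-> ideal_span (fun q => exists2 m, A m & q = 'X_[m]) p.

Definition monomial_ideal I : Prop := exists A, generates A I.

(* G = G(I). Monomials are represented by their exponent vectors, so that     *)
(* divisibility is the pointwise order ( _ <= _ )%MM. Restricting to finite   *)
(* sets loses nothing, by Dickson's lemma.                                    *)
Definition minimal_monomial_generators I (G : {fset 'X_{1..n}}) : Prop :=
  generates (fun m => m \in G) I /\
  forall H : {fset 'X_{1..n}}, H `<` G -> ~ generates (fun m => m \in H) I.

Definition variables_ideal : {mpoly K[n]} -> Prop :=
  ideal_span (fun p => exists i : 'I_n, p = 'X_i).

End MonomialIdeals.

Section Covers.
Variables (n : nat) (G : {fset 'X_{1..n}}).
Implicit Types (A C D V : {set G}) (u v w : G).

(* The lcm of the empty set is the monomial 1, with exponent vector 0%MM.     *)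
Definition mdegree A : 'X_{1..n} := \big[@mlcm n/0%MM]_(u in A) val u.

Definition cover_of C u : bool :=
  (u \in C) && (val u <= mdegree (C :\ u))%MM.

Definition is_cover C : bool := [exists u, cover_of C u].

Definition cover_closure C : {set G} := [set w | (val w <= mdegree C)%MM].

Definition complete_cover C : bool :=
  [exists V, is_cover V && (C == cover_closure V)].

Definition M_minimal C : bool :=
  is_cover C &&
  ~~ [exists V, [&& is_cover V, (mdegree V <= mdegree C)%MM
                  & mdegree V != mdegree C]].

Definition out_set C D : bool :=
  [&& D \subset C, mdegree D == mdegree C
    & ~~ [exists V : {set G}, (V \proper D) && (mdegree V == mdegree D)]].

Definition inner_points C : {set G} :=
  [set u in C | ~~ [exists D, out_set C D && (u \in D)]].

Definition exchangeable C u : bool :=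
  (u \in C :\: inner_points C) &&
  [forall D, out_set C D && (u \in D) ==>
    [forall v in C :\: D, mdegree (v |: (D :\ u)) == mdegree D]].

Definition exchangeable_points C : {set G} := [set u in C | exchangeable C u].

End Covers.

Definition strict_total_order (T : eqType) (prec : rel T) : Prop :=
  [/\ irreflexive prec, transitive prec
    & forall u v, u != v -> prec u v || prec v u].

Section Orders.
Variables (T : finType) (prec : rel T).

Definition least (A : {set T}) : option T :=
  [pick u in A | [forall v in A, (v == u) || prec u v]].

(* min(A) < min(B), with A < set0 for nonempty A and never set0 < B.          *)
Definition set_prec (A B : {set T}) : bool :=
  match least A, least B with
  | Some a, Some b => prec a b
  | Some _, None => true
  | None, _ => false
  end.

End Orders.

Section Lyubeznik.
Variables (K : fieldType) (n : nat) (G : {fset 'X_{1..n}}) (prec : rel G).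

Definition lyubeznik_face (F : {set G}) : bool :=
  [forall H : {set G}, (H != set0) && (H \subset F) ==>
    (if least prec [set u | (val u <= mdegree H)%MM] is Some u
     then u \in H else false)].

Definition lyubeznik_cell (i : nat) :=
  {F : {set G} | lyubeznik_face F && (#|F| == i)}.

(* The free module L_i over {mpoly K[n]}, in coordinates on its basis.        *)
Definition lyubeznik_module (i : nat) :=
  {ffun lyubeznik_cell i -> {mpoly K[n]}^o}.

(* The basis element of L_i given by F (0 if F is not a face of size i).      *)
Definition lyubeznik_basis (i : nat) (F : {set G}) : lyubeznik_module i :=
  [ffun H => (val H == F)%:R].

Lemma lyubeznik_faceS (F H : {set G}) :
  H \subset F -> lyubeznik_face F -> lyubeznik_face H.
Proof.
move=> sHF /forallP faceF; apply/forallP => V; apply/implyP => /andP[V0 sVH].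
by have := faceF V; rewrite V0 (subset_trans sVH sHF).
Qed.

(* phi_i : L_(i+1) -> L_i for i > 0. If u is the k-th element of the face F   *)
(* in increasing order, then k - 1 = #|{v in F : v < u}|, so the sign below   *)
(* is (-1)^(k+1). Since F :\ u is again a face (lyubeznik_faceS), no term is  *)
(* lost in lyubeznik_basis.                                                   *)
Definition lyubeznik_diff (i : nat) (w : lyubeznik_module i.+1) :
    lyubeznik_module i :=
  \sum_(F : lyubeznik_cell i.+1) w F *:
    \sum_(u in val F)
      ((-1) ^+ #|[set v in val F | prec v u]| *
       'X_[mdegree (val F) - mdegree (val F :\ u)]) *:
      lyubeznik_basis i (val F :\ u).

Definition lyubeznik_minimal : Prop :=
  forall i : nat, (0 < i)%N -> forall w : lyubeznik_module i.+1,
    ideal_scale (@variables_ideal K n) (lyubeznik_diff w).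

End Lyubeznik.

(* Main.v *)
Require Import Defs.
From HB Require Import structures.
From mathcomp Require Import all_boot all_algebra.

(** Minimality of the resolution says that no Lyubeznik face with at least two
elements is a cover.  Let [a] be the least element of [C].  If a subset [V] of
[C] is not a face, there are [H] in [V] and [b] outside [H] such that [b] is the
least generator dividing [m(H)]; then [b |: H] is a cover, so M-minimality forces
[m(H) = m(C)], whence [b = a].  Thus every cover [V] in [C] with at least two
elements satisfies [m(V :\ a) = m(C)].  If [a] lies in an out set [D], applying
this to [v |: D] for [v] in [C :\: D] gives [m(v |: D :\ a) = m(C)]: hence [a] is
exchangeable, and every such [v] lies in an out set, so there are no inner
points.  Otherwise [a] itself is an inner point. *)

Set Implicit Arguments.
Unset Strict Implicit.
Unset Printing Implicit Defensive.

Import GRing.Theory.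

(** * Least elements of a strict total order *)

Section Least.
Variables (T : finType) (prec : rel T).
Hypothesis hprec : strict_total_order prec.
Implicit Types (A B : {set T}) (a : T).

Lemma leastP A a :
  reflect (a \in A /\ {in A, forall v, v = a \/ prec a v}) (least prec A == Some a).
Proof.
have [irr tr _] := hprec.
rewrite /least; apply: (iffP eqP) => [|[aA amin]].
  case: pickP => // b /andP[bA /forallP bmin] [<-]; split=> // v vA.
  by have := bmin v; rewrite vA /= => /orP[/eqP|]; [left | right].
case: pickP => [b /andP[bA /forallP bmin]|/(_ a)].
  have := bmin a; rewrite aA /= => /orP[/eqP->//|ba].
  have [->//|ab] := amin _ bA.
  by have := tr _ _ _ ab ba; rewrite irr.
rewrite aA /= => /negP[]; apply/forallP=> v; apply/implyP => /amin[->|->].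
  by rewrite eqxx.
by rewrite orbT.
Qed.

Lemma least_exists A : A != set0 -> exists a, least prec A == Some a.
Proof.
have [irr tr tot] := hprec.
case/set0Pn => x xA.
(* An element of [A] with the fewest predecessors in [A] is least: by transitivity and
   irreflexivity, any predecessor of it would have strictly fewer. *)
case: (arg_minnP (fun u => #|[set v in A | prec v u]|) xA) => a aA amin.
exists a; apply/leastP; split=> // v vA.
have [->|neq] := eqVneq v a; first by left.
have [|va] := orP (tot _ _ neq); last by right.
move=> va; have := amin v vA; rewrite leqNgt => /negP[].
apply: proper_card; apply/properP; split; last first.
  by exists v; rewrite inE vA ?irr.
apply/subsetP => w; rewrite !inE => /andP[->] /= wv; exact: tr wv va.
Qed.

Lemma leastS A B a :
  B \subset A -> a \in B -> least prec A == Some a -> least prec B == Some a.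
Proof.
move=> /subsetP sBA aB /leastP[_ amin].
by apply/leastP; split=> // v /sBA/amin.
Qed.

(** The minimum of [B] is again [a], while the minimum of [A :\: B], if there is one, is an element
    of [A] other than [a]. Both order claims of the theorem come from this. *)
Lemma set_prec_setD A B a :
  least prec A == Some a -> a \in B -> B \subset A -> set_prec prec B (A :\: B).
Proof.
move=> hA aB sBA; rewrite /set_prec (eqP (leastS sBA aB hA)).
case E: (least prec _) => [b|//]; move/eqP/leastP: E => -[].
rewrite inE => /andP[bB bA] _; have /leastP[_ amin] := hA.
by have [eba|//] := amin _ bA; rewrite eba aB in bB.
Qed.

End Least.

(** * The lcm of monomials as a commutative monoid law *)

Section MonomialLcm.
Variable n : nat.

Lemma mlcmA : associative (@mlcm n).
Proof. by move=> k1 k2 k3; apply/mnmP => i; rewrite !mnmE maxnA. Qed.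

HB.instance Definition _ :=
  Monoid.isComLaw.Build 'X_{1..n} 0%MM (@mlcm n) mlcmA (@mlcmC n) (@mlc0m n).

End MonomialLcm.

(** * Multidegrees, covers and out sets *)

Section Multidegree.
Variables (n : nat) (G : {fset 'X_{1..n}}).
Implicit Types (A B C D V : {set G}) (u v w : G) (k : 'X_{1..n}).

Lemma lepm_anti k1 k2 : (k1 <= k2)%MM -> (k2 <= k1)%MM -> k1 = k2.
Proof.
move=> /mnm_lepP h1 /mnm_lepP h2; apply/mnmP => i.
by apply/eqP; rewrite eqn_leq h1 h2.
Qed.

Lemma mdegree_leP A k :
  reflect {in A, forall u, (val u <= k)%MM} (mdegree A <= k)%MM.
Proof.
rewrite /mdegree; apply: (iffP idP) => [|h].
  move=> h u uA; apply: lepm_trans h.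
  by rewrite (big_setD1 u) //= lem_mlcml.
elim/big_ind: _ => [|x y hx hy|//]; last by rewrite lem_mlcm hx.
by apply/mnm_lepP => i; rewrite mnmE.
Qed.

Lemma le_mdegree A u : u \in A -> (val u <= mdegree A)%MM.
Proof. by move=> uA; apply: (mdegree_leP _ _ (lepm_refl _)). Qed.

Lemma mdegreeS A B : A \subset B -> (mdegree A <= mdegree B)%MM.
Proof.
by move=> /subsetP sAB; apply/mdegree_leP => u /sAB/le_mdegree.
Qed.

Lemma mdegreeU1 A u : (val u <= mdegree A)%MM -> mdegree (u |: A) = mdegree A.
Proof.
move=> hu; apply: lepm_anti; last exact/mdegreeS/subsetUr.
by apply/mdegree_leP => v /setU1P[->//|/le_mdegree].
Qed.

Lemma mdegree_cover_closure C : mdegree (cover_closure C) = mdegree C.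
Proof.
apply: lepm_anti; first by apply/mdegree_leP => u; rewrite inE.
by apply/mdegreeS/subsetP => u /le_mdegree; rewrite inE.
Qed.

Lemma complete_coverP C : complete_cover C -> cover_closure C = C.
Proof.
case/existsP => V /andP[_ /eqP->]; apply/setP => w.
by rewrite !inE mdegree_cover_closure.
Qed.

Lemma coverU1 A u : u \notin A -> (val u <= mdegree A)%MM -> is_cover (u |: A).
Proof.
move=> uA hu; apply/existsP; exists u.
by rewrite /cover_of setU11 setU1K.
Qed.

Lemma M_minimal_mdegree C V :
  M_minimal C -> is_cover V -> V \subset C -> mdegree V = mdegree C.
Proof.
case/andP => _ /existsPn/(_ V) h hV sVC; apply/eqP; apply/negPn/negP => ne.
by rewrite hV ne mdegreeS in h.
Qed.

Lemma out_set_exists C V :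
  V \subset C -> mdegree V = mdegree C -> exists2 D, out_set C D & D \subset V.
Proof.
(* An inclusion-minimal subset of [V] with multidegree m(C) is an out set. *)
move=> sVC hV; pose P (A : {set G}) := mdegree A == mdegree C.
have [|D /minsetP[/eqP hD Dmin] sDV] := @minset_exists _ P V.
  by rewrite /P hV.
exists D => //; rewrite /out_set (subset_trans sDV sVC) hD eqxx /=.
apply/existsPn => A; apply/negP => /andP[pA hA].
by have := Dmin A hA (proper_sub pA); move: pA => /[swap] ->; rewrite properxx.
Qed.

Lemma out_setD1 C D u : out_set C D -> u \in D -> mdegree (D :\ u) != mdegree C.
Proof.
case/and3P => _ /eqP hD /existsPn/(_ (D :\ u)).
by rewrite hD => h uD; rewrite properD1 in h.
Qed.

Lemma notin_inner_pointsP C u :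
  u \in C -> reflect (exists2 D, out_set C D & u \in D) (u \notin inner_points C).
Proof.
move=> uC; rewrite inE uC negbK.
apply: (iffP existsP) => [[D /andP[]]|[D oD uD]]; first by exists D.
by exists D; rewrite oD.
Qed.

End Multidegree.

(** * From minimality of the resolution to irredundancy of faces *)

Section ResolutionMinimality.
Variables (K : fieldType) (n : nat) (G : {fset 'X_{1..n}}) (prec : rel G).
Local Open Scope ring_scope.

(** Evaluation at the origin kills every variable but no unit, so it can detect a unit coefficient
    in the differential. *)
Lemma variables_ideal_meval0 (p : {mpoly K[n]}) :
  variables_ideal p -> p.@[fun=> 0] = 0.
Proof.
case=> s [hs ->]; rewrite rmorph_sum big_seq big1 // => x xs.
by have [i ->] := hs x xs; rewrite rmorphM /= mevalXU mulr0.
Qed.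

Lemma ideal_scale_variables_coord i (w : lyubeznik_module K prec i) c :
  ideal_scale (@variables_ideal K n) w -> (w c).@[fun=> 0] = 0.
Proof.
case=> s [hs ->]; rewrite sum_ffunE rmorph_sum big_seq big1 // => x xs.
by rewrite ffunE rmorphM /= (variables_ideal_meval0 (hs x xs)) mul0r.
Qed.

Lemma lyubeznik_diff_basis i (F : lyubeznik_cell prec i.+1) :
  lyubeznik_diff (lyubeznik_basis K prec i.+1 (val F)) =
  \sum_(u in val F)
      ((-1) ^+ #|[set v in val F | prec v u]| *
       'X_[mdegree (val F) - mdegree (val F :\ u)]) *:
      lyubeznik_basis K prec i (val F :\ u).
Proof.
rewrite /lyubeznik_diff (bigD1 F) //= ffunE eqxx scale1r [X in _ + X]big1 ?addr0 // => H ne.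
by rewrite ffunE val_eqE (negPf ne) scale0r.
Qed.

(** If deleting [u] kept the multidegree, the differential of [F] would have the coefficient 1 or -1
    on [F :\ u], which is not in the ideal of the variables. *)
Lemma minimal_face_mdegreeD1 (F : {set G}) u :
  lyubeznik_minimal K prec -> lyubeznik_face prec F -> (1 < #|F|)%N -> u \in F ->
  mdegree (F :\ u) != mdegree F.
Proof.
move=> hmin faceF cF uF; apply/negP => /eqP eq_deg.
have [i i0 cFi] : exists2 i, (0 < i)%N & #|F| = i.+1.
  by exists #|F|.-1; case: #|F| cF => [|[]].
have pF : lyubeznik_face prec F && (#|F| == i.+1) by rewrite faceF cFi eqxx.
have pFu : lyubeznik_face prec (F :\ u) && (#|F :\ u| == i).
  rewrite (lyubeznik_faceS (subD1set F u) faceF) /=.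
  by rewrite -eqSS -cFi [in X in _ == X](cardsD1 u) uF.
pose c : lyubeznik_cell prec i := Sub (F :\ u) pFu.
pose d : lyubeznik_cell prec i.+1 := Sub F pF.
have := ideal_scale_variables_coord c
  (hmin i i0 (lyubeznik_basis K prec i.+1 (val d))).
(* Only the term of [u] reaches the coordinate [F :\ u], since deleting another element of [F] gives
   a different face. *)
rewrite lyubeznik_diff_basis /= sum_ffunE (bigD1 u) //= big1 => [|v /andP[vF ne]].
  rewrite addr0 !ffunE eqxx eq_deg -{1}[mdegree F]add0m addmK mpolyX0 mulr1 /= [_ *: _]mulr1.
  rewrite rmorphXn rmorphN1 => /eqP; by rewrite signr_eq0.
rewrite !ffunE; suff /negPf-> : F :\ u != F :\ v by rewrite scaler0.
by apply/eqP => /setP/(_ v); rewrite !inE eqxx vF ne.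
Qed.

End ResolutionMinimality.

(** * The least element of an M-minimal complete cover *)

Section MMinimalCovers.
Variables (n : nat) (G : {fset 'X_{1..n}}) (prec : rel G).
Hypothesis hprec : strict_total_order prec.
Hypothesis face_irredundant : forall (F : {set G}) u,
  lyubeznik_face prec F -> 1 < #|F| -> u \in F -> mdegree (F :\ u) != mdegree F.
Variables (C : {set G}) (a : G).
Hypothesis hC : complete_cover C.
Hypothesis hM : M_minimal C.
Hypothesis least_a : least prec C == Some a.
Implicit Types (D H V : {set G}).

Lemma not_face_mdegreeD1 V :
  V \subset C -> ~~ lyubeznik_face prec V -> mdegree (V :\ a) = mdegree C.
Proof.
move=> sVC /forallPn[H]; rewrite negb_imply => /andP[/andP[H0 sHV]].
set A := [set u | _]; have sHA : H \subset A.
  by apply/subsetP => u /le_mdegree; rewrite inE.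
have [|b hb] := least_exists hprec (A := A).
  by apply: contraNneq H0 => A0; rewrite -subset0 -A0.
rewrite (eqP hb) => bH; have /leastP -/(_ hprec) [] := hb.
rewrite inE => hbm _; have sHC := subset_trans sHV sVC.
(* As [C] is complete, it contains [b], which divides m(H) and hence m(C). *)
have bC : b \in C.
  by rewrite -(complete_coverP hC) inE; apply: lepm_trans hbm (mdegreeS sHC).
have hH : mdegree H = mdegree C.
  rewrite -(mdegreeU1 hbm) (M_minimal_mdegree hM) ?coverU1 //.
  by rewrite subUset sub1set bC.
(* The generators dividing m(H) = m(C) are exactly those in [C], so [b] is [a]. Since [b] is not in
   [H], it follows that [H] lies in [V :\ a]. *)
have AC : A = C by rewrite -[RHS](complete_coverP hC) /A hH.
move: hb; rewrite AC (eqP least_a) => /eqP[eab].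
apply: lepm_anti; first exact/mdegreeS/(subset_trans (subD1set _ _)).
by rewrite -hH; apply/mdegreeS; rewrite subsetD1 sHV eab.
Qed.

Lemma cover_mdegreeD1 V :
  V \subset C -> is_cover V -> 1 < #|V| -> mdegree (V :\ a) = mdegree C.
Proof.
move=> sVC /existsP[u /andP[uV hu]] cV; apply: not_face_mdegreeD1 => //.
apply/negP => /face_irredundant/(_ cV uV)/negP[].
by rewrite -[in X in _ == X](setD1K uV) mdegreeU1.
Qed.

Lemma out_set_exchange D v :
  out_set C D -> a \in D -> v \in C :\: D -> mdegree (v |: D :\ a) = mdegree C.
Proof.
move=> /and3P[sDC /eqP hD _] aD /setDP[vC vD].
(* The two sets agree because [v] differs from [a], which lies in [D]. *)
have -> : v |: D :\ a = (v |: D) :\ a.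
  by rewrite setDUl [[set v] :\ a](setDidPl _) // disjoints1 inE; apply: contraNneq vD => ->.
apply: cover_mdegreeD1.
- by rewrite subUset sub1set vC.
- by rewrite coverU1 // hD le_mdegree.
- by rewrite cardsU1 vD (cardD1 a) aD.
Qed.

Lemma least_exchangeable : a \notin inner_points C -> exchangeable C a.
Proof.
have /leastP -/(_ hprec) [aC _] := least_a => aI.
rewrite /exchangeable inE aI aC /=; apply/forallP => D; apply/implyP => /andP[oD aD].
apply/forallP => v; apply/implyP => vCD.
by rewrite out_set_exchange // eq_sym; case/and3P: oD.
Qed.

Lemma inner_points_eq0 : a \notin inner_points C -> inner_points C = set0.
Proof.
have /leastP -/(_ hprec) [aC _] := least_a.
case/(notin_inner_pointsP aC) => D oD aD.
have sDC : D \subset C by case/and3P: oD.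
apply/setP => x; rewrite [RHS]inE; apply/negP => xI.
have xC : x \in C by move: xI; rewrite inE => /andP[].
suff /negP[] : x \notin inner_points C by [].
apply/notin_inner_pointsP => //.
have [xD|xD] := boolP (x \in D); first by exists D.
(* For [x] outside [D], an out set [D'] is taken inside [x |: D :\ a]. If it missed [x], it would
   lie in [D :\ a], forcing m(D \ a) = m(C) and contradicting the minimality of [D]. *)
have sV : x |: D :\ a \subset C.
  by rewrite subUset sub1set xC (subset_trans (subD1set _ _)).
have [|D' oD' sD'] := out_set_exists sV.
  by apply: out_set_exchange => //; rewrite inE xD.
exists D' => //; apply/negPn/negP => xD'; have /negP[] := out_setD1 oD aD.
have [_ /eqP hD' _] := and3P oD'; apply/eqP/lepm_anti.
  exact/mdegreeS/(subset_trans (subD1set _ _)).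
rewrite -hD'; apply/mdegreeS/subsetP => y yD'.
have := subsetP sD' _ yD'; case/setU1P => // eyx.
by rewrite -eyx yD' in xD'.
Qed.

End MMinimalCovers.

Theorem proposition4p2 (K : fieldType) (n : nat)
  (I : {mpoly K[n]} -> Prop) (hI : monomial_ideal I)
  (G : {fset 'X_{1..n}}) (hG : minimal_monomial_generators I G)
  (prec : rel G) (hprec : strict_total_order prec)
  (hmin : lyubeznik_minimal K prec)
  (C : {set G}) (hC : complete_cover C) (hM : M_minimal C) :
  let IC := inner_points C in
  let EC := exchangeable_points C in
  [/\ IC != set0 \/ EC != set0,
      (IC != set0) (+) ((IC == set0) && (EC != set0)),
      IC != set0 -> set_prec prec IC (C :\: IC)
    & IC = set0 /\ EC != set0 -> set_prec prec EC (C :\: EC)].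
Proof.
move=> IC EC.
have hface F u := @minimal_face_mdegreeD1 K n G prec F u hmin.
have sIC : IC \subset C by apply/subsetP => x; rewrite inE => /andP[].
have sEC : EC \subset C by apply/subsetP => x; rewrite inE => /andP[].
have [a la] : exists a, least prec C == Some a.
  apply: least_exists => //; case/andP: hM => /existsP[u /andP[uC _]] _.
  by apply/set0Pn; exists u.
have /leastP -/(_ hprec) [aC _] := la.
(* Whether [a] is inner decides between the two cases; in each of them [a] belongs to the set that
   has to come first. *)
have [aI|aI] := boolP (a \in IC).
  have IC0 : IC != set0 by apply/set0Pn; exists a.
  split; [by left|by rewrite (negPf IC0)|by move=> _; apply: set_prec_setD la _ _|].
  by case=> IC0'; rewrite IC0' eqxx in IC0.
have IC0 := inner_points_eq0 hprec hface hC hM la aI.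
have aE : a \in EC by rewrite inE aC (least_exchangeable hprec hface hC hM la aI).
have EC0 : EC != set0 by apply/set0Pn; exists a.
rewrite -/IC in IC0; rewrite IC0 eqxx EC0; split=> //; first by right.
by move=> _; apply: set_prec_setD la _ _.
Qed.
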